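(* Fix $t$ and $j\le k$. For a weight vector $\omega=(\omega_\ell)_{\ell\in\mathcal A_t}$ on the simplex ($\omega_\ell\ge0$, $\sum_\ell\omega_\ell=1$) let $\mathcal V_{t,j}(\omega)=\sum_{\ell\in\mathcal A_t}\omega_\ell^2\vartheta^2_{\ell,t,j}/n_t^\ell$. Then $\mathcal V_{t,j}(\omega)\ge\mathcal I_{t,j}^{-1}$, with equality if and only if $\omega=\omega^{\mathrm{opt}}_{\cdot,t,j}$, and $$\frac{\mathcal V_{t,j}(\omega)}{\mathcal I_{t,j}^{-1}}-1=\mathcal I_{t,j}\sum_{\ell\in\mathcal A_t}\frac{\vartheta^2_{\ell,t,j}}{n_t^\ell}(\omega_\ell-\omega^{\mathrm{opt}}_{\ell,t,j})^2=\sum_{\ell\in\mathcal A_t}\omega^{\mathrm{opt}}_{\ell,t,j}\Bigl(\frac{\omega_\ell}{\omega^{\mathrm{opt}}_{\ell,t,j}}-1\Bigr)^2\le\max_{\ell\in\mathcal A_t}\Bigl|\frac{\omega_\ell}{\omega^{\mathrm{opt}}_{\ell,t,j}}-1\Bigr|^2 .$$ Moreover, irrespective of any calibration of the temperature, under the temperature assumption and the batch-balance assumption stated in the context, the soft-max weights $\omega=\omega_{\cdot,t,j}$ satisfy $$\frac{\mathcal V_{t,j}(\omega)}{\mathcal I_{t,j}^{-1}}\le C_\omega^2C_{\mathrm{bal}}\frac{T_{t,j}}{\inf_{\ell\in\mathcal A_t}\vartheta^2_{\ell,t,j}}=O(1).$$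
   Context: $\mathcal A_t$ is the finite set of active nodes at time $t$, $A_t=|\mathcal A_t|$; $n_t^\ell\ge1$ is the batch size of node $\ell$, $N_t=\sum_{\ell\in\mathcal A_t}n_t^\ell$. $\vartheta^2_{\ell,t,j}>0$ is the local asymptotic variance of node $\ell$'s debiased estimator of the spike $\lambda_{t,j}$: $\vartheta^2_{\ell,t,j}=2\chi_{\ell,t}(\lambda_{t,j})^2/\chi'_{\ell,t}(\lambda_{t,j})^2$, where in the canonical case $\chi_{\ell,t}(\lambda)=\frac{\lambda(\lambda+\sigma_t^2)}{\lambda+c_{\ell,t-1}\sigma_t^2}$, $c_{\ell,t-1}$ being the local aspect ratio. The standing assumptions $0<\sigma_{\min}^2\le\sigma_t^2\le\sigma_{\max}^2<\infty$, $\lambda_{t,1}\le\lambda_{\max}<\infty$, aspect ratios bounded by $\bar c<\infty$, and every spike above its critical threshold ($\lambda_{t,k}>\sigma_t^2\sqrt{c_{\ell,t}}$ uniformly in the canonical case) make $\vartheta^2_{\ell,t,j}$ bounded above and below by positive constants uniformly in $\ell,t,j$; this is what $O(1)$ refers to. $T_{t,j}=\sup_{\ell\in\mathcal A_t}\vartheta^2_{\ell,t,j}$. Oracle weights: $\omega^{\mathrm{opt}}_{\ell,t,j}=\frac{n_t^\ell/\vartheta^2_{\ell,t,j}}{\sum_{m\in\mathcal A_t}n_t^m/\vartheta^2_{m,t,j}}$, $\mathcal I_{t,j}=\sum_{\ell\in\mathcal A_t}n_t^\ell/\vartheta^2_{\ell,t,j}$. Soft-max weights: $\omega_{\ell,t,j}=\frac{\exp(-\tilde\tau_t\Psi_{\ell,t,j})}{\sum_{m\in\mathcal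 A_t}\exp(-\tilde\tau_t\Psi_{m,t,j})}$, where $\Psi_{\ell,t,j}$ is the ratio $V_{\ell,t-1,j}/\bar V_{t-1,j}$ of the (nonnegative) fluctuation metric of node $\ell$ to its average over $\mathcal A_t$, clipped to $[\underline\theta,\bar\theta]$. Temperature assumption: $0<\underline\theta\le\bar\theta<\infty$ and $\tilde\tau_t\in[\underline\tau,\bar\tau]$ with $0<\underline\tau\le\bar\tau<\infty$. $C_\omega=\exp\{\bar\tau(\bar\theta-\underline\theta)\}$. Batch-balance assumption: there is $C_{\mathrm{bal}}<\infty$ with $\min_{\ell\in\mathcal A_t}n_t^\ell\ge N_t/(C_{\mathrm{bal}}A_t)$ for all $t$. *)

(* Defs.v *)
From mathcomp Require Import all_boot all_order all_algebra finmap.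
From mathcomp Require Import all_classical all_reals all_analysis.
Set Implicit Arguments.
Unset Strict Implicit.
Unset Printing Implicit Defensive.
Import Order.TTheory GRing.Theory Num.Theory.
Import numFieldNormedType.Exports.
Local Open Scope fset_scope.
Local Open Scope classical_set_scope.
Local Open Scope ring_scope.

(* Rounds are numbered t = 1, 2, ... (so that t.-1 is the previous round) and
   spikes j = 1, ..., rank; index 0 of a round is only used for quantities
   "at t - 1" when t = 1, and index 0 of a spike is never used. *)
Record federation (R : realType) := Federation {
  node : choiceType;
  active : nat -> {fset node};          (* active nodes at time t *)
  batch : node -> nat -> nat;           (* n_t^l *)
  rank : nat;                           (* k *)
  spike : nat -> nat -> R;              (* lambda_{t,j} *)
  noise : nat -> R;                     (* the variance sigma_t^2 *)
  aspect : node -> nat -> R;            (* c_{l,t} *)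
  chi : node -> nat -> R -> R;          (* chi_{l,t} *)
  fluct : node -> nat -> nat -> R;      (* V_{l,t,j} *)
  temp : nat -> R                       (* soft-max temperature at time t *)
}.

Section Definitions.
Context {R : realType} (F : federation R).
Implicit Types (l : node F) (t j : nat) (w : node F -> R).

Definition nsamp l t : R := (batch l t)%:R.
Definition nactive t : R := (#|` active F t |)%:R.
Definition ntotal t : R := \sum_(l <- active F t) nsamp l t.

Definition vartheta2 l t j : R :=
  2 * chi l t (spike F t j) ^+ 2 / (derive1 (chi l t) (spike F t j)) ^+ 2.

Definition canonical_chi l t (x : R) : R :=
  x * (x + noise F t) / (x + aspect l t.-1 * noise F t).

Definition vartheta2_set t j : set R :=
  [set vartheta2 l t j | l in [set x | x \in active F t]].

Definition info t j : R := \sum_(l <- active F t) nsamp l t / vartheta2 l t j.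

Definition oracle_weight t j l : R := (nsamp l t / vartheta2 l t j) / info t j.

Definition in_simplex t w : Prop :=
  (forall l, l \in active F t -> 0 <= w l) /\ \sum_(l <- active F t) w l = 1.

Definition agg_var t j w : R :=
  \sum_(l <- active F t) w l ^+ 2 * vartheta2 l t j / nsamp l t.

(* The default 0 is harmless: the terms are nonnegative. *)
Definition max_sq_dev t j w : R :=
  \big[Num.max/0]_(l <- active F t) `|w l / oracle_weight t j l - 1| ^+ 2.

Definition mean_fluct t j : R :=
  (\sum_(l <- active F t) fluct l t.-1 j) / nactive t.

Definition clip (lo hi x : R) : R := Num.min (Num.max x lo) hi.

Definition Psi (thlo thhi : R) t j l : R :=
  clip thlo thhi (fluct l t.-1 j / mean_fluct t j).

Definition softmax_weight (thlo thhi : R) t j l : R :=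
  expR (- (temp F t * Psi thlo thhi t j l)) /
  \sum_(m <- active F t) expR (- (temp F t * Psi thlo thhi t j m)).

Definition well_formed : Prop := forall t, (0 < t)%N ->
  [/\ active F t != fset0,
      forall l, l \in active F t -> (1 <= batch l t)%N
    & forall l j, l \in active F t -> (1 <= j <= rank F)%N ->
        0 <= fluct l t.-1 j].

Definition positive_variances : Prop := forall t l j,
  (0 < t)%N -> l \in active F t -> (1 <= j <= rank F)%N -> 0 < vartheta2 l t j.

Definition temperature_assumption (thlo thhi taulo tauhi : R) : Prop :=
  [/\ 0 < thlo, thlo <= thhi, 0 < taulo, taulo <= tauhi
    & forall t, (0 < t)%N -> taulo <= temp F t <= tauhi].

(* The minimum of the batch sizes is at least N_t / (Cbal A_t). *)
Definition batch_balance (Cbal : R) : Prop := 0 < Cbal /\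
  forall t l, (0 < t)%N -> l \in active F t ->
    ntotal t / (Cbal * nactive t) <= nsamp l t.

Definition C_omega (thlo thhi tauhi : R) : R := expR (tauhi * (thhi - thlo)).

Definition softmax_bound (thlo thhi tauhi Cbal : R) t j : R :=
  C_omega thlo thhi tauhi ^+ 2 * Cbal *
  (sup (vartheta2_set t j) / inf (vartheta2_set t j)).

Definition bounded_variances (vlo vhi : R) : Prop := forall t l j,
  (0 < t)%N -> l \in active F t -> (1 <= j <= rank F)%N ->
  vlo <= vartheta2 l t j <= vhi.

(* Canonical case. [gap] is the uniform margin by which the spikes exceed
   the critical thresholds. A node active at time t has an aspect ratio both
   at time t (in the threshold) and at time t - 1 (in chi). *)
Definition canonical_standing
    (sigma2min sigma2max lambdamax cbar gap : R) : Prop :=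
  forall t, (0 < t)%N ->
  [/\ sigma2min <= noise F t <= sigma2max,
      spike F t 1 <= lambdamax,
      forall i j, (1 <= i)%N -> (i <= j <= rank F)%N ->
        spike F t j <= spike F t i
    & forall l, l \in active F t ->
      [/\ chi l t =1 canonical_chi l t,
          0 < aspect l t.-1 <= cbar,
          0 < aspect l t <= cbar
        & noise F t * Num.sqrt (aspect l t) + gap <= spike F t (rank F)]].

End Definitions.

Arguments softmax_weight {R} F thlo thhi t j l.
Arguments Psi {R} F thlo thhi t j l.
Arguments oracle_weight {R} F t j l.

(* Main.v *)
Require Import Defs.
From mathcomp Require Import all_boot all_order all_algebra finmap.
From mathcomp Require Import all_classical all_reals all_analysis.
From mathcomp Require Import ring.
Set Implicit Arguments.
Unset Strict Implicit.
Unset Printing Implicit Defensive.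
Import Order.TTheory GRing.Theory Num.Theory.
Import numFieldNormedType.Exports.
Local Open Scope fset_scope.
Local Open Scope classical_set_scope.
Local Open Scope ring_scope.

(** Write [p l] for the precision [n_l / vartheta2_l] and [I] for the sum of the
    precisions, so that the oracle weights are [p l / I] and the aggregated
    variance is the diagonal quadratic form [\sum_l w l ^+ 2 / p l].

    Oracle weights. On the hyperplane [\sum_l w l = 1] the quadratic form is
    minimal at [p / I], where its gradient is constant; completing the square
    there has no linear term and leaves [inverse_variance_excess]: the excess
    over [I^-1] is the quadratic form at [w - p / I]. Since it is positive
    definite, this one identity gives the lower bound, its equality case and
    the excess formula. Scaled by [I], the excess is the average of the squared
    relative deviations under the oracle weights themselves, hence at most
    their maximum.

    Soft-max weights. The exponents range over an interval of length at most
    [tauhi * (thhi - thlo)], so whatever the fluctuations are, each weight is at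
    most [C_omega] times the uniform weight [1 / A] ([softmax_le_uniform]).
    Batch balance bounds each [1 / n_l] by [Cbal * A / N]. The aggregated
    variance is therefore at most [A * (C_omega / A) ^+ 2 * T * Cbal * A / N],
    in which [A] cancels, while [I] is at most [N] over the smallest local
    variance, so [N] cancels in the product ([capped_weights_efficiency]).

    Uniform bound. The local variance is [2 * (chi / chi') ^+ 2], and in the
    canonical case [chi / chi'] is an explicit rational function
    ([canonical_chi_ratio]) with positive coefficients, which is bounded above
    and away from 0 when the spike, the noise and the aspect ratio are bounded
    and the spike is bounded away from 0 ([canonical_ratio_bounds]). *)

(** * Sums over a sequence *)

Lemma sumr_seq_gt0 (R : numDomainType) (T : eqType) (s : seq T) (f : T -> R) :
  s != [::] -> {in s, forall l, 0 < f l} -> 0 < \sum_(l <- s) f l.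
Proof.
case: s => [//|x s] _ fgt0; rewrite big_cons ltr_pwDl ?fgt0 ?mem_head//.
by rewrite big_seq sumr_ge0// => l ls; rewrite ltW// fgt0// inE ls orbT.
Qed.

Lemma sumr_seq_le_const (R : numDomainType) (T : eqType) (s : seq T)
    (f : T -> R) (c : R) :
  {in s, forall l, f l <= c} -> \sum_(l <- s) f l <= (size s)%:R * c.
Proof.
move=> fc; have -> : (size s)%:R * c = \sum_(l <- s) c.
  by rewrite big_const_seq count_predT iter_addr_0 mulr_natl.
by rewrite big_seq [leRHS]big_seq ler_sum.
Qed.

Lemma sumr_seq_ge_const (R : numDomainType) (T : eqType) (s : seq T)
    (f : T -> R) (c : R) :
  {in s, forall l, c <= f l} -> (size s)%:R * c <= \sum_(l <- s) f l.
Proof.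
move=> cf; rewrite -lerN2 -mulrN -sumrN; apply: sumr_seq_le_const => l ls.
by rewrite lerN2 cf.
Qed.

(** * Inverse-variance weighting *)

(** Expanding the square, the cross term is [2 / I * \sum_l w l] and the last
    one [\sum_l p l / I ^+ 2], because the [p l] in the oracle weight cancels
    against the division by [p l]; together they are [- I^-1]. *)
Lemma inverse_variance_excess (R : fieldType) (T : eqType) (s : seq T)
    (p w : T -> R) :
  {in s, forall l, p l != 0} -> \sum_(l <- s) p l != 0 ->
  \sum_(l <- s) w l = 1 ->
  \sum_(l <- s) w l ^+ 2 / p l - (\sum_(l <- s) p l)^-1 =
  \sum_(l <- s) (w l - p l / \sum_(m <- s) p m) ^+ 2 / p l.
Proof.
move=> p0; set I := \sum_(l <- s) p l => I0 w1.
transitivity (\sum_(l <- s) (w l ^+ 2 / p l - w l * (2 / I) + p l * I ^- 2)).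
  rewrite big_split sumrB/= -!mulr_suml w1 -/I.
  by field.
rewrite big_seq [RHS]big_seq; apply: eq_bigr => l /p0 pl0.
by field; rewrite pl0.
Qed.

Lemma relative_excess (R : fieldType) (T : eqType) (s : seq T)
    (p w : T -> R) (I : R) :
  {in s, forall l, p l != 0} -> I != 0 ->
  I * \sum_(l <- s) (w l - p l / I) ^+ 2 / p l =
  \sum_(l <- s) p l / I * (w l / (p l / I) - 1) ^+ 2.
Proof.
move=> p0 I0; rewrite mulr_sumr big_seq [RHS]big_seq; apply: eq_bigr => l ls.
by field; rewrite I0 p0.
Qed.

Lemma convex_comb_le_bigmax (R : realDomainType) (T : eqType) (s : seq T)
    (o f : T -> R) :
  {in s, forall l, 0 <= o l} -> \sum_(l <- s) o l = 1 ->
  \sum_(l <- s) o l * f l <= \big[Num.max/0]_(l <- s) f l.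
Proof.
move=> o0 o1; rewrite -[leRHS]mul1r -o1 mulr_suml big_seq [leRHS]big_seq.
by apply: ler_sum => l ls; rewrite ler_wpM2l ?o0// le_bigmax_seq.
Qed.

(** Each of the [size s] terms of the aggregated variance is at most
    [(C / A) ^+ 2 * vhi * (B * A / N)], with [A] the number of nodes and [N] the
    total of the [n l], and the total precision is at most [N / vlo]: both [A]
    and [N] cancel in the product. *)
Lemma capped_weights_efficiency (R : realFieldType) (T : eqType) (s : seq T)
    (n v w : T -> R) (vlo vhi B C : R) :
  s != [::] -> 0 < vlo -> 0 < B ->
  {in s, forall l, 0 < n l} ->
  {in s, forall l, (\sum_(m <- s) n m) / (B * (size s)%:R) <= n l} ->
  {in s, forall l, vlo <= v l <= vhi} ->
  {in s, forall l, 0 <= w l <= C / (size s)%:R} ->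
  (\sum_(l <- s) w l ^+ 2 * v l / n l) * (\sum_(l <- s) n l / v l)
    <= C ^+ 2 * B * (vhi / vlo).
Proof.
move=> s0 vlo0 B0 n0 nbal vb wb.
set N := \sum_(m <- s) n m; set A : R := (size s)%:R.
have N0 : 0 < N by exact: sumr_seq_gt0.
have A0 : 0 < A by rewrite ltr0n lt0n size_eq0.
have vl0 l : l \in s -> 0 < v l.
  by move=> /vb/andP[+ _]; exact: lt_le_trans.
have aggb : \sum_(l <- s) w l ^+ 2 * v l / n l
    <= A * ((C / A) ^+ 2 * vhi * (B * A / N)).
  apply: sumr_seq_le_const => l ls.
  have /andP[_ vle] := vb l ls; have /andP[w0 wle] := wb l ls.
  apply: ler_pM => //; first by rewrite mulr_ge0 ?sqr_ge0// ltW// vl0.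
  - by rewrite invr_ge0 ltW// n0.
  - apply: ler_pM; rewrite ?sqr_ge0 ?(ltW (vl0 _ ls))//.
    by rewrite ler_sqr ?nnegrE// (le_trans w0).
  - rewrite -[leRHS]invrK lef_pV2 ?posrE ?n0// ?invr_gt0 ?divr_gt0 ?mulr_gt0//.
    by rewrite invf_div nbal.
have infob : \sum_(l <- s) n l / v l <= N / vlo.
  rewrite /N mulr_suml big_seq [leRHS]big_seq; apply: ler_sum => l ls.
  have /andP[vge _] := vb l ls.
  by rewrite ler_wpM2l ?(ltW (n0 _ ls))// lef_pV2 ?posrE ?vl0.
have -> : C ^+ 2 * B * (vhi / vlo)
    = A * ((C / A) ^+ 2 * vhi * (B * A / N)) * (N / vlo).
  by field; rewrite !gt_eqF//.
apply: ler_pM => //; rewrite big_seq sumr_ge0// => l ls.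
  by rewrite divr_ge0 ?(mulr_ge0 (sqr_ge0 _))// ltW ?vl0 ?n0.
by rewrite divr_ge0// ltW ?vl0 ?n0.
Qed.

(** * Soft-max weights *)

(** The numerator is at most [expR (- lo)] and each of the terms of the
    normalization is at least [expR (- hi)]. *)
Lemma softmax_le_uniform (R : realType) (T : eqType) (s : seq T) (f : T -> R)
    (lo hi : R) :
  {in s, forall l, lo <= f l <= hi} ->
  {in s, forall l, 0 <= expR (- f l) / (\sum_(m <- s) expR (- f m))
                     <= expR (hi - lo) / (size s)%:R}.
Proof.
move=> fb l ls.
have A0 : 0 < (size s)%:R :> R by rewrite ltr0n; case: (s) ls.
have Zge : (size s)%:R * expR (- hi) <= \sum_(m <- s) expR (- f m).
  apply: sumr_seq_ge_const => m /fb /andP[_ fm].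
  by rewrite ler_expR lerN2.
have hi0 : 0 < (size s)%:R * expR (- hi) by rewrite mulr_gt0// expR_gt0.
have Z0 := lt_le_trans hi0 Zge.
rewrite divr_ge0 ?expR_ge0 ?(ltW Z0)//=.
have -> : expR (hi - lo) / (size s)%:R
    = expR (- lo) / ((size s)%:R * expR (- hi)).
  by rewrite addrC expRD invfM [expR (- hi)]expRN invrK; ring.
have /andP[lof _] := fb l ls.
by apply: ler_pM; rewrite ?expR_ge0 ?invr_ge0 ?(ltW Z0)// ?ler_expR ?lerN2//
  lef_pV2 ?posrE.
Qed.

Lemma clip_itv (R : realType) (lo hi x : R) :
  lo <= hi -> lo <= clip lo hi x <= hi.
Proof.
by move=> lohi; rewrite /clip le_min le_max lexx orbT lohi ge_min lexx orbT.
Qed.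

(** * Efficiency of the oracle and soft-max weights *)

Lemma active_neq_nil (R : realType) (F : federation R) (t : nat) :
  well_formed F -> (0 < t)%N -> (active F t : seq (node F)) != [::].
Proof.
move=> wF /wF[/fset0Pn[l ls] _ _].
by apply: contraTneq (ls : l \in enum_fset (active F t)) => ->.
Qed.

Lemma nsamp_gt0 (R : realType) (F : federation R) (t : nat) :
  well_formed F -> (0 < t)%N -> {in active F t, forall l, 0 < nsamp l t}.
Proof. by move=> wF /wF[_ + _] l ls => /(_ l ls); rewrite ltr0n. Qed.

Lemma agg_varE (R : realType) (F : federation R) (t j : nat) (w : node F -> R) :
  agg_var t j w =
  \sum_(l <- active F t) w l ^+ 2 / (nsamp l t / vartheta2 l t j).
Proof.
by apply: eq_bigr => l _; rewrite invf_div [RHS]mulrA.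
Qed.

Lemma has_ubound_vartheta2 (R : realType) (F : federation R) (t j : nat) :
  has_ubound (vartheta2_set F t j).
Proof.
exists (\big[Num.max/0]_(l <- active F t) vartheta2 l t j) => _ [l ls <-].
exact: (@le_bigmax_seq _ _ _ _ 0 l predT).
Qed.

Lemma has_lbound_vartheta2 (R : realType) (F : federation R) (t j : nat) :
  has_lbound (vartheta2_set F t j).
Proof.
exists (\big[Num.min/0]_(l <- active F t) vartheta2 l t j) => _ [l ls <-].
exact: ge_bigmin_seq.
Qed.

Lemma vartheta2_set_neq0 (R : realType) (F : federation R) (t j : nat) :
  well_formed F -> (0 < t)%N -> vartheta2_set F t j !=set0.
Proof.
by move=> wF /wF[/fset0Pn[l ls] _ _]; exists (vartheta2 l t j); exists l.
Qed.

(** Only finitely many nodes are active, so pointwise positivity suffices. *)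
Lemma inf_vartheta2_gt0 (R : realType) (F : federation R) (t j : nat) :
  well_formed F -> positive_variances F -> (0 < t)%N -> (1 <= j <= rank F)%N ->
  0 < inf (vartheta2_set F t j).
Proof.
move=> wF pF t0 jr.
apply: (@lt_le_trans _ _ (\big[Num.min/1]_(l <- active F t) vartheta2 l t j)).
  by rewrite big_seq; apply: lt_bigmin => // l ls; exact: pF.
apply: lb_le_inf; first exact: vartheta2_set_neq0.
by move=> _ [l ls <-]; exact: ge_bigmin_seq.
Qed.

Lemma vartheta2_between (R : realType) (F : federation R) (t j : nat) :
  {in active F t, forall l, inf (vartheta2_set F t j) <= vartheta2 l t j
                              <= sup (vartheta2_set F t j)}.
Proof.
move=> l ls; apply/andP; split.
  by apply: ge_inf; [exact: has_lbound_vartheta2|exists l].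
by apply: ub_le_sup; [exact: has_ubound_vartheta2|exists l].
Qed.

Lemma oracle_efficiency (R : realType) (F : federation R) :
  well_formed F -> positive_variances F ->
  forall t j : nat, (0 < t)%N -> (1 <= j <= rank F)%N ->
  forall w : node F -> R, in_simplex t w ->
  [/\ (info F t j)^-1 <= agg_var t j w,
      agg_var t j w = (info F t j)^-1 <->
        (forall l, l \in active F t -> w l = oracle_weight F t j l),
      agg_var t j w / (info F t j)^-1 - 1 =
        info F t j * \sum_(l <- active F t)
          vartheta2 l t j / nsamp l t * (w l - oracle_weight F t j l) ^+ 2,
      info F t j * \sum_(l <- active F t)
          vartheta2 l t j / nsamp l t * (w l - oracle_weight F t j l) ^+ 2 =
        \sum_(l <- active F t)
          oracle_weight F t j l * (w l / oracle_weight F t j l - 1) ^+ 2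
    & \sum_(l <- active F t)
          oracle_weight F t j l * (w l / oracle_weight F t j l - 1) ^+ 2
        <= max_sq_dev t j w].
Proof.
move=> wF pF t j t0 jr w [_ w1].
pose p (l : node F) := nsamp l t / vartheta2 l t j.
have p_gt0 : {in active F t, forall l, 0 < p l}.
  by move=> l ls; apply: divr_gt0; [exact: nsamp_gt0|exact: pF].
have p_neq0 : {in active F t, forall l, p l != 0}.
  by move=> l ls; rewrite gt_eqF ?p_gt0.
have I_gt0 : 0 < info F t j by apply: sumr_seq_gt0 => //; exact: active_neq_nil.
have I_neq0 : info F t j != 0 by rewrite gt_eqF.
have excess := inverse_variance_excess p_neq0 I_neq0 w1.
rewrite -agg_varE -/(info F t j) in excess.
set D := \sum_(l <- _) _ in excess.
have DE : \sum_(l <- active F t)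
    vartheta2 l t j / nsamp l t * (w l - oracle_weight F t j l) ^+ 2 = D.
  by apply: eq_bigr => l _; rewrite [LHS]mulrC -[_ / nsamp _ _]invf_div.
have D_ge0 l : l \in active F t -> 0 <= (w l - p l / info F t j) ^+ 2 / p l.
  by move=> ls; rewrite divr_ge0 ?sqr_ge0// ltW// p_gt0.
rewrite DE; split.
- by rewrite -subr_ge0 excess /D big_seq sumr_ge0.
- split=> [/eqP|wE].
    rewrite -subr_eq0 excess /D big_seq psumr_eq0// => /allP D0 l ls.
    have := D0 l ls; rewrite ls/= mulf_eq0 invr_eq0 (negbTE (p_neq0 l ls)) orbF.
    by rewrite sqrf_eq0 subr_eq0 => /eqP.
  apply/eqP; rewrite -subr_eq0 excess /D big_seq big1// => l ls.
  by rewrite wE// /oracle_weight subrr expr0n mul0r.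
- by rewrite -excess; field.
- exact: relative_excess.
- have -> : max_sq_dev t j w = \big[Num.max/0]_(l <- active F t)
      (w l / oracle_weight F t j l - 1) ^+ 2.
    by apply: eq_bigr => l _; rewrite real_normK ?num_real.
  apply: convex_comb_le_bigmax => [l ls|].
    by rewrite divr_ge0 ?(ltW I_gt0) ?(ltW (p_gt0 l ls)).
  by rewrite -mulr_suml divff.
Qed.

Lemma softmax_weight_le (R : realType) (F : federation R)
    (thlo thhi taulo tauhi : R) (t j : nat) :
  temperature_assumption F thlo thhi taulo tauhi -> (0 < t)%N ->
  {in active F t, forall l, 0 <= softmax_weight F thlo thhi t j l
    <= C_omega thlo thhi tauhi / nactive F t}.
Proof.
move=> [_ lohi taulo0 _ tauP] t0 l ls.
have /andP[tau_ge tau_le] := tauP t t0.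
have tau_gt0 := lt_le_trans taulo0 tau_ge.
have fb : {in active F t, forall m, temp F t * thlo
    <= temp F t * Psi F thlo thhi t j m <= temp F t * thhi}.
  move=> m _; rewrite !ler_pM2l//; exact: clip_itv.
have /andP[w_ge0 w_le] := softmax_le_uniform fb ls.
rewrite w_ge0 (le_trans w_le)// -mulrBr.
by rewrite ler_wpM2r ?invr_ge0// ler_expR ler_wpM2r// subr_ge0.
Qed.

Lemma softmax_efficiency (R : realType) (F : federation R)
    (thlo thhi taulo tauhi Cbal : R) :
  well_formed F -> positive_variances F ->
  temperature_assumption F thlo thhi taulo tauhi -> batch_balance F Cbal ->
  forall t j : nat, (0 < t)%N -> (1 <= j <= rank F)%N ->
  agg_var t j (softmax_weight F thlo thhi t j) / (info F t j)^-1
    <= softmax_bound F thlo thhi tauhi Cbal t j.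
Proof.
move=> wF pF tF [C0 bal] t j t0 jr; rewrite invrK.
apply: capped_weights_efficiency => //.
- exact: active_neq_nil.
- exact: inf_vartheta2_gt0.
- exact: nsamp_gt0.
- by move=> l ls; exact: bal.
- exact: vartheta2_between.
- exact: softmax_weight_le tF t0.
Qed.

(** The explicit bound is monotone in the two extreme local variances, so it is
    largest when they are [vhi] and [vlo]. *)
Lemma softmax_efficiency_bounded (R : realType)
    (thlo thhi taulo tauhi Cbal vlo vhi : R) (F : federation R) :
  0 < vlo -> well_formed F -> bounded_variances F vlo vhi ->
  temperature_assumption F thlo thhi taulo tauhi -> batch_balance F Cbal ->
  forall t j : nat, (0 < t)%N -> (1 <= j <= rank F)%N ->
  agg_var t j (softmax_weight F thlo thhi t j) / (info F t j)^-1
    <= softmax_bound F thlo thhi tauhi Cbal t j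
    <= C_omega thlo thhi tauhi ^+ 2 * Cbal * (vhi / vlo).
Proof.
move=> vlo0 wF bF tF cF t j t0 jr.
have pF : positive_variances F.
  move=> t' l j' t'0 ls j'r; have /andP[+ _] := bF t' l j' t'0 ls j'r.
  exact: lt_le_trans.
apply/andP; split; first exact: softmax_efficiency tF cF t j t0 jr.
have S0 := vartheta2_set_neq0 j wF t0.
have vlo_inf : vlo <= inf (vartheta2_set F t j).
  by apply: lb_le_inf => // _ [l ls <-]; have /andP[] := bF t l j t0 ls jr.
have sup_vhi : sup (vartheta2_set F t j) <= vhi.
  by apply: ge_sup => // _ [l ls <-]; have /andP[] := bF t l j t0 ls jr.
have sup_ge0 : 0 <= sup (vartheta2_set F t j).
  have [_ [l ls _]] := S0; have /andP[_] := vartheta2_between j ls.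
  by apply: le_trans; rewrite ltW// pF.
have inf_gt0 := lt_le_trans vlo0 vlo_inf.
apply: ler_wpM2l; first exact: mulr_ge0 (sqr_ge0 _) (ltW cF.1).
by apply: ler_pM => //; rewrite ?invr_ge0 ?(ltW inf_gt0)// lef_pV2.
Qed.

(** * Local variances in the canonical case *)

(** The derivative of [x * (x + s) / (x + c * s)] is
    [(x ^+ 2 + 2 * (c * s) * x + c * s ^+ 2) / (x + c * s) ^+ 2], whose numerator
    is positive for positive [x]. *)
Lemma canonical_chi_ratio (R : realType) (F : federation R) (l : node F)
    (t : nat) (x : R) :
  0 < x -> 0 < aspect l t.-1 -> 0 < noise F t ->
  canonical_chi l t x / derive1 (canonical_chi l t) x =
  x * (x + noise F t) * (x + aspect l t.-1 * noise F t) /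
  (x ^+ 2 + 2 * (aspect l t.-1 * noise F t) * x
     + aspect l t.-1 * noise F t ^+ 2).
Proof.
move=> x0; set c := aspect l t.-1; set s := noise F t => c0 s0.
have cs0 : 0 < c * s by rewrite mulr_gt0.
have d0 : x + c * s != 0 by rewrite gt_eqF// addr_gt0.
have q0 : 0 < x ^+ 2 + 2 * (c * s) * x + c * s ^+ 2.
  by rewrite !addr_gt0 ?mulr_gt0// exprn_gt0.
have dchi : is_derive x 1 (canonical_chi l t)
    ((x ^+ 2 + 2 * (c * s) * x + c * s ^+ 2) / (x + c * s) ^+ 2).
  rewrite /canonical_chi -/s -/c.
  have ? := @is_deriveV R (fun y => y + c * s) x 1 1 d0.
  apply: is_derive_eq.
  rewrite /GRing.scale/=; field; exact: d0.
rewrite derive1E (@derive_val _ _ _ _ _ _ _ dchi) /canonical_chi -/s -/c.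
by field; rewrite d0 gt_eqF.
Qed.

Definition canonical_ratio_lo (R : fieldType) (g L S C : R) : R :=
  g ^+ 3 / (L ^+ 2 + 2 * (C * S) * L + C * S ^+ 2).

Definition canonical_ratio_hi (R : fieldType) (g L S C : R) : R :=
  L * (L + S) * (L + C * S) / g ^+ 2.

Lemma canonical_ratio_lo_gt0 (R : realFieldType) (g L S C : R) :
  0 < g -> 0 < L -> 0 < S -> 0 < C -> 0 < canonical_ratio_lo g L S C.
Proof.
move=> g0 L0 S0 C0; have CS0 : 0 < C * S by exact: mulr_gt0.
have CSL0 : 0 < 2 * (C * S) * L by rewrite !mulr_gt0.
have CSS0 : 0 < C * S ^+ 2 by rewrite mulr_gt0// exprn_gt0.
by rewrite divr_gt0 ?exprn_gt0// !addr_gt0// exprn_gt0.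
Qed.

(** Every factor of the numerator and every term of the denominator is
    increasing in [x], [s] and [c], so each can be bounded separately; for the
    two bounds that use [g], the numerator is at least [x ^+ 3] and the
    denominator at least [x ^+ 2]. *)
Lemma canonical_ratio_bounds (R : realFieldType) (x s c g L S C : R) :
  0 < g -> 0 < s -> 0 < c -> g <= x <= L -> s <= S -> c <= C ->
  canonical_ratio_lo g L S C <=
  x * (x + s) * (x + c * s) / (x ^+ 2 + 2 * (c * s) * x + c * s ^+ 2) <=
  canonical_ratio_hi g L S C.
Proof.
move=> g0 s0 c0 /andP[gx xL] sS cC.
have x0 : 0 < x := lt_le_trans g0 gx.
have L0 : 0 < L := lt_le_trans x0 xL.
have S0 : 0 < S := lt_le_trans s0 sS.
have C0 : 0 < C := lt_le_trans c0 cC.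
have cs0 : 0 < c * s by exact: mulr_gt0.
have csx0 : 0 < 2 * (c * s) * x by rewrite !mulr_gt0.
have css0 : 0 < c * s ^+ 2 by rewrite mulr_gt0// exprn_gt0.
have q0 : 0 < x ^+ 2 + 2 * (c * s) * x + c * s ^+ 2.
  by rewrite !addr_gt0// exprn_gt0.
have csCS : c * s <= C * S by apply: ler_pM => //; exact: ltW.
have g2x2 : g ^+ 2 <= x ^+ 2 by rewrite ler_sqr ?nnegrE// ltW.
have g20 : 0 < g ^+ 2 by rewrite exprn_gt0.
have num0 : 0 < x * (x + s) * (x + c * s) by rewrite !mulr_gt0// addr_gt0.
have qM : x ^+ 2 + 2 * (c * s) * x + c * s ^+ 2
    <= L ^+ 2 + 2 * (C * S) * L + C * S ^+ 2.
  apply: lerD; first apply: lerD.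
  - by rewrite ler_sqr ?nnegrE// ltW.
  - by apply: ler_pM => //; rewrite ?ler_wpM2l ?mulr_ge0// ltW.
  - by rewrite !expr2 !mulrA; apply: ler_pM => //; exact: ltW.
have M0 := lt_le_trans q0 qM.
apply/andP; split.
  apply: ler_pM; rewrite ?invr_ge0 ?exprn_ge0 ?(ltW g0) ?(ltW M0)//; last first.
    by rewrite lef_pV2.
  rewrite !exprS expr0 mulr1 mulrA.
  apply: ler_pM; rewrite ?mulr_ge0 ?(ltW g0)//; last first.
    by rewrite (le_trans gx)// lerDl ltW.
  by apply: ler_pM; rewrite ?(ltW g0)// (le_trans gx)// lerDl ltW.
apply: ler_pM; rewrite ?invr_ge0 ?(ltW q0) ?(ltW num0)//; last first.
  rewrite lef_pV2// (le_trans g2x2)//.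
  by rewrite -addrA lerDl ltW// addr_gt0.
apply: ler_pM; last by rewrite lerD.
- by rewrite ltW// mulr_gt0// addr_gt0.
- by rewrite ltW// addr_gt0.
by apply: ler_pM => //; rewrite ?lerD// ltW// addr_gt0.
Qed.

(** The margin [gap] keeps the spikes away from 0, since the thresholds are
    nonnegative; a single active node then forces the uniform upper bounds to be
    positive. *)
Lemma canonical_standing_pos (R : realType) (F : federation R)
    (sigma2min sigma2max lambdamax cbar gap : R) (t : nat) (l : node F) :
  0 < sigma2min -> 0 < gap ->
  canonical_standing F sigma2min sigma2max lambdamax cbar gap ->
  (0 < t)%N -> (0 < rank F)%N -> l \in active F t ->
  [/\ 0 < sigma2max, 0 < lambdamax & 0 < cbar].
Proof.
move=> smin0 g0 cF t0 k0 ls.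
have [/andP[s_ge s_le] lam1 lam_mono lP] := cF t t0.
have [_ /andP[c0 c_le] _ above] := lP l ls.
have s0 := lt_le_trans smin0 s_ge.
split; [exact: lt_le_trans s_le| |exact: lt_le_trans c_le].
apply: lt_le_trans lam1; apply: lt_le_trans g0 _.
apply: le_trans (lam_mono 1%N (rank F) _ _); rewrite ?leqnn ?k0//.
by apply: le_trans above; rewrite lerDr mulr_ge0 ?sqrtr_ge0// ltW.
Qed.

Lemma canonical_bounded_variances (R : realType) (F : federation R)
    (sigma2min sigma2max lambdamax cbar gap : R) :
  0 < sigma2min -> 0 < gap ->
  canonical_standing F sigma2min sigma2max lambdamax cbar gap ->
  bounded_variances F
    (2 * canonical_ratio_lo gap lambdamax sigma2max cbar ^+ 2)
    (2 * canonical_ratio_hi gap lambdamax sigma2max cbar ^+ 2).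
Proof.
move=> smin0 g0 cF t l j t0 ls jr; have /andP[j1 jk] := jr.
have [/andP[s_ge s_le] lam1 lam_mono lP] := cF t t0.
have [chiE /andP[c0 c_le] /andP[c'0 _] above] := lP l ls.
have s0 : 0 < noise F t := lt_le_trans smin0 s_ge.
have gx : gap <= spike F t j.
  apply: le_trans (lam_mono j (rank F) j1 _); last by rewrite jk leqnn.
  by apply: le_trans above; rewrite lerDr mulr_ge0 ?sqrtr_ge0// ltW.
have xL : spike F t j <= lambdamax.
  by apply: le_trans lam1; apply: lam_mono.
have x0 : 0 < spike F t j := lt_le_trans g0 gx.
have xb : gap <= spike F t j <= lambdamax by rewrite gx.
have := canonical_ratio_bounds g0 s0 c0 xb s_le c_le.
rewrite -canonical_chi_ratio//.
have -> : vartheta2 l t j =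
    2 * (canonical_chi l t (spike F t j)
         / derive1 (canonical_chi l t) (spike F t j)) ^+ 2.
  by rewrite /vartheta2 (_ : chi l t = canonical_chi l t) ?expr_div_n ?mulrA//;
    apply/funext.
set lo := canonical_ratio_lo _ _ _ _; set r : R := canonical_chi l t _ / _; move=> /andP[lor rhi].
have lo0 : 0 <= lo.
  have [S0 L0 C0] :=
    canonical_standing_pos smin0 g0 cF t0 (leq_trans j1 jk) ls.
  by rewrite ltW// canonical_ratio_lo_gt0.
have r0 := le_trans lo0 lor.
by rewrite !ler_pM2l// !ler_sqr ?nnegrE ?lor ?rhi// (le_trans r0).
Qed.

Theorem proposition3 (R : realType) :
  (* efficiency of the oracle weights and the exact excess-variance formula *)
  (forall (F : federation R), well_formed F -> positive_variances F ->
   forall t j : nat, (0 < t)%N -> (1 <= j <= rank F)%N ->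
   forall w : node F -> R, in_simplex t w ->
   [/\ (info F t j)^-1 <= agg_var t j w,
       agg_var t j w = (info F t j)^-1 <->
         (forall l, l \in active F t -> w l = oracle_weight F t j l),
       agg_var t j w / (info F t j)^-1 - 1 =
         info F t j * \sum_(l <- active F t)
           vartheta2 l t j / nsamp l t * (w l - oracle_weight F t j l) ^+ 2,
       info F t j * \sum_(l <- active F t)
           vartheta2 l t j / nsamp l t * (w l - oracle_weight F t j l) ^+ 2 =
         \sum_(l <- active F t)
           oracle_weight F t j l * (w l / oracle_weight F t j l - 1) ^+ 2
     & \sum_(l <- active F t)
           oracle_weight F t j l * (w l / oracle_weight F t j l - 1) ^+ 2
         <= max_sq_dev t j w]) /\
  (* soft-max weights: explicit bound *)
  (forall (F : federation R) (thlo thhi taulo tauhi Cbal : R),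
   well_formed F -> positive_variances F ->
   temperature_assumption F thlo thhi taulo tauhi -> batch_balance F Cbal ->
   forall t j : nat, (0 < t)%N -> (1 <= j <= rank F)%N ->
   agg_var t j (softmax_weight F thlo thhi t j) / (info F t j)^-1
     <= softmax_bound F thlo thhi tauhi Cbal t j) /\
  (* that bound is O(1), whenever the local variances are uniformly bounded *)
  (forall thlo thhi taulo tauhi Cbal vlo vhi : R, 0 < vlo ->
   exists K : R, forall F : federation R,
   well_formed F -> bounded_variances F vlo vhi ->
   temperature_assumption F thlo thhi taulo tauhi -> batch_balance F Cbal ->
   forall t j : nat, (0 < t)%N -> (1 <= j <= rank F)%N ->
   agg_var t j (softmax_weight F thlo thhi t j) / (info F t j)^-1
     <= softmax_bound F thlo thhi tauhi Cbal t j <= K) /\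
  (* in particular in the canonical case, from the standing assumptions *)
  (forall thlo thhi taulo tauhi Cbal
          sigma2min sigma2max lambdamax cbar gap : R,
   0 < sigma2min -> 0 < gap ->
   exists K : R, forall F : federation R,
   well_formed F ->
   canonical_standing F sigma2min sigma2max lambdamax cbar gap ->
   temperature_assumption F thlo thhi taulo tauhi -> batch_balance F Cbal ->
   forall t j : nat, (0 < t)%N -> (1 <= j <= rank F)%N ->
   agg_var t j (softmax_weight F thlo thhi t j) / (info F t j)^-1
     <= softmax_bound F thlo thhi tauhi Cbal t j <= K).
Proof.
split; first by move=> F; exact: oracle_efficiency.
split.
  move=> F thlo thhi taulo tauhi Cbal wF pF tF balF t j t0 jr.
  exact: softmax_efficiency tF balF t j t0 jr.
split.
  move=> thlo thhi taulo tauhi Cbal vlo vhi vlo0.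
  exists (C_omega thlo thhi tauhi ^+ 2 * Cbal * (vhi / vlo)).
  move=> F wF bF tF balF t j t0 jr.
  exact: softmax_efficiency_bounded tF balF t j t0 jr.
move=> thlo thhi taulo tauhi Cbal smin smax lmax cbar gap smin0 g0.
exists (C_omega thlo thhi tauhi ^+ 2 * Cbal *
  (2 * canonical_ratio_hi gap lmax smax cbar ^+ 2 /
   (2 * canonical_ratio_lo gap lmax smax cbar ^+ 2))).
move=> F wF cF tF balF t j t0 jr; have /andP[j1 jk] := jr.
have bF := canonical_bounded_variances smin0 g0 cF.
(* The parameters are only known to be positive once some node is active. *)
have [/fset0Pn[l ls] _ _] := wF t t0.
have [S0 L0 C0] :=
  canonical_standing_pos smin0 g0 cF t0 (leq_trans j1 jk) ls.
apply: (softmax_efficiency_bounded _ wF bF tF balF t0 jr).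
by rewrite mulr_gt0// exprn_gt0// canonical_ratio_lo_gt0.
Qed.
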